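(* Let $\Omega\subset\mathbb{R}^n$ be open, let $\Phi:\Omega\times\mathbb{R}^m\to[0,\infty]$ be a strong $\Phi$-function with the following property: for every $K>0$ there exists $\beta>0$ such that for all balls $B\subset\mathbb{R}^n$ with $\mu(B)\le1$ and all $\xi\in\mathbb{R}^m$, \[ \Phi_B^+(\beta\xi)\le\Phi_B^-(\xi)+1\qquad\text{whenever }\Phi_B^-(\xi)\le\tfrac{K}{\mu(B)}. \] Let $f\in L^\Phi_\mu(\Omega;\mathbb{R}^m)$. Then there exists $\beta>0$ such that, if $\varrho_\Phi(f)\le1$, then for every ball $B\subset\mathbb{R}^n$ with $\mu(B)\le1$, \[ \Phi_B^+\bigg(\beta\,\frac1{\mu(B)}\int_B f\,d\mu\bigg)\le\frac1{\mu(B)}\int_B\Phi(x,f)\,d\mu+1 . \]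
   Context: Here $\mu$ is a fixed Borel measure on $\mathbb{R}^n$; ''a.e.'', $\operatorname{ess\,inf}$ and $\operatorname{ess\,sup}$ are with respect to $\mu$. Only balls $B$ with $\mu(B\cap\Omega)>0$ are considered, and functions defined on $\Omega$ (both $f$ and $x\mapsto\Phi(x,f(x))$) are understood as $0$ outside $\Omega$ in integrals over $B$. A function $\Phi:\Omega\times\mathbb{R}^m\to[0,\infty]$ is a strong $\Phi$-function if: (1) $x\mapsto\Phi(x,\xi)$ is measurable for every $\xi\in\mathbb{R}^m$; (2) $\Phi(x,0)=\lim_{\xi\to0}\Phi(x,\xi)=0$ and $\lim_{\xi\to\infty}\Phi(x,\xi)=\infty$ (i.e. as $|\xi|\to\infty$) for a.e. $x\in\Omega$; (3) $\xi\mapsto\Phi(x,\xi)$ is continuous in the topology of $[0,\infty]$ for a.e. $x\in\Omega$; (4) $\xi\mapsto\Phi(x,\xi)$ is convex for a.e. $x\in\Omega$. For a ball $B$, $\Phi_B^-(\xi):=\operatorname{ess\,inf}_{x\in B\cap\Omega}\Phi(x,\xi)$ and $\Phi_B^+(\xi):=\operatorname{ess\,sup}_{x\in B\cap\Omega}\Phi(x,\xi)$. For $v\in L^1_\mu(\Omega;\mathbb{R}^m)$, $\varrho_\Phi(v):=\int_\Omega\Phi(x,v(x))\,d\mu$ and $\|v\|_\Phi:=\inf\{\lambda>0\mid\varrho_\Phi(v/\lambda)\le1\}$. The space $L^\Phi_\mu(\Omega;\mathbb{R}^m)$ consists of those $v\in L^1_\mu(\Omega;\mathbb{R}^m)$ with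 $\|v\|_\Phi<\infty$. *)

(* Defs.v *)
From HB Require Import structures.
From mathcomp Require Import all_boot all_order all_algebra.
From mathcomp Require Import all_classical all_reals all_analysis.
From mathcomp Require Import measurable_realfun ess_sup_inf.
Set Implicit Arguments.
Unset Strict Implicit.
Unset Printing Implicit Defensive.
Import Order.TTheory GRing.Theory Num.Theory.
Import numFieldNormedType.Exports.
Local Open Scope classical_set_scope.
Local Open Scope ring_scope.

(** R^k as a measurable space: row vectors with the Borel sigma-algebra.  A Borel
    measure on R^n is a measure on [borelRn R n]. *)
Definition borelRn (R : realType) (k : nat) :=
  g_sigma_algebraType (@open 'rV[R]_k).

(** The library norm on ['rV_k] is the sup norm, hence this definition. *)
Definition enorm (R : realType) (k : nat) (v : 'rV[R]_k) : R :=
  Num.sqrt (\sum_(j < k) v 0 j ^+ 2).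

Definition eball (R : realType) (k : nat) (c : 'rV[R]_k) (r : R) :
    set 'rV[R]_k :=
  [set y | enorm (y - c) < r].

(** The filter "|xi| -> oo" on R^k. *)
Definition enorm_infty (R : realType) (k : nat) : set_system 'rV[R]_k :=
  filter_from [set: R] (fun r => [set v | r < enorm v]).

Section strong_Phi_functions.
Context (R : realType) (n m : nat).
Variable mu : {measure set (borelRn R n) -> \bar R}.
Implicit Types (Omega B : set 'rV[R]_n) (v : 'rV[R]_n -> 'rV[R]_m).
Implicit Types (Phi : 'rV[R]_n -> 'rV[R]_m -> \bar R) (xi : 'rV[R]_m).

(** Functions on [Omega] are total functions on R^n; only their values on
    [Omega] are constrained or used. *)
Record strong_Phi_function Omega Phi : Prop := StrongPhiFunction {
  Phi_ge0 : forall x xi, Omega x -> (0 <= Phi x xi)%E ;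
  Phi_measurable : forall xi,
    measurable_fun (Omega : set (borelRn R n)) (fun x => Phi x xi) ;
  Phi_at0 : \forall x \ae mu, Omega x -> Phi x 0 = 0%E ;
  Phi_cvg0 : \forall x \ae mu, Omega x -> Phi x xi @[xi --> (0 : 'rV[R]_m)^'] --> 0%E ;
  Phi_cvg_infty : \forall x \ae mu, Omega x ->
    Phi x xi @[xi --> @enorm_infty R m] --> +oo%E ;
  Phi_continuous : \forall x \ae mu, Omega x -> continuous (Phi x) ;
  Phi_convex : \forall x \ae mu, Omega x ->
    forall (xi eta : 'rV[R]_m) (t : R), 0 <= t <= 1 ->
      (Phi x (t *: xi + (1 - t) *: eta)%R
         <= t%:E * Phi x xi + (1 - t)%R%:E * Phi x eta)%E
}.

(** Essential infimum and supremum over [B `&` Omega]: off this set the function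
    is given the value that is neutral for the operation. *)
Definition Phi_minus Omega Phi B xi : \bar R :=
  ess_inf mu (patch (cst +oo%E) (B `&` Omega) (fun x => Phi x xi)).

Definition Phi_plus Omega Phi B xi : \bar R :=
  ess_sup mu (patch (cst -oo%E) (B `&` Omega) (fun x => Phi x xi)).

Definition L1_vec Omega v : Prop :=
  measurable_fun (Omega : set (borelRn R n)) (v : borelRn R n -> borelRn R m)
  /\ (\int[mu]_(x in Omega) (enorm (v x))%:E < +oo)%E.

Definition modular Omega Phi v : \bar R :=
  (\int[mu]_(x in Omega) Phi x (v x))%E.

Definition Luxemburg_norm Omega Phi v : \bar R :=
  ereal_inf [set l%:E | l in
    [set l : R | 0 < l /\ (modular Omega Phi (fun x => l^-1 *: v x)%R <= 1)%E]].

Definition LPhi Omega Phi v : Prop :=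
  L1_vec Omega v /\ (Luxemburg_norm Omega Phi v < +oo)%E.

(** [1/mu(B) \int_B v], with [v] extended by 0 outside [Omega]; the integral of
    an R^m-valued function is taken coordinatewise. *)
Definition vec_mean Omega B v : 'rV[R]_m :=
  (fine (mu B))^-1 *: \row_j \int[mu]_(x in B) (patch (fun=> 0) Omega v x 0 j).

Definition Phi_mean Omega Phi B v : \bar R :=
  ((mu B)^-1 * \int[mu]_(x in B) patch (fun=> 0) Omega (fun y => Phi y (v y)) x)%E.

(** Only balls charging [Omega] are considered. *)
Definition ball_condition Omega Phi : Prop :=
  forall K : R, 0 < K -> exists beta : R, 0 < beta /\
    forall (c : 'rV[R]_n) (r : R), 0 < r ->
    let B := eball c r in
    (mu B <= 1)%E -> (0 < mu (B `&` Omega))%E ->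
    forall xi : 'rV[R]_m,
      (Phi_minus Omega Phi B xi <= K%:E / mu B)%E ->
      (Phi_plus Omega Phi B (beta *: xi) <= Phi_minus Omega Phi B xi + 1)%E.

End strong_Phi_functions.

(* Main.v *)
Require Import Defs.
From HB Require Import structures.
From mathcomp Require Import all_boot all_order all_algebra.
From mathcomp Require Import all_classical all_reals all_analysis.
From mathcomp Require Import measurable_realfun ess_sup_inf.
From mathcomp Require Import ring lra.
Import Order.TTheory GRing.Theory Num.Theory.
Import numFieldNormedType.Exports.
Local Open Scope classical_set_scope.
Local Open Scope ring_scope.
Set Implicit Arguments.
Unset Strict Implicit.
Unset Printing Implicit Defensive.

(** Write [a := 1 / mu B >= 1].  Two obstacles separate the statement from
    Jensen's inequality: the essential infimum of convex functions is not
    convex, and the ball condition compares values of [Phi] at different points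
    only where they are at most a multiple of [a].

    The first one is avoided by never working with [Phi_minus] as a function.
    Applying the ball condition with [K = 2] at the countably many points of a
    dense set, and then using continuity, yields one null set off which
    [Phi y (beta * xi) <= Phi x xi + 1] for all pairs [x], [y] and all [xi] with
    [Phi x xi <= a] ([strong_Phi_ae_transfer]).  From there on [y] is fixed and
    only the single convex function [Phi y] has to be estimated at the mean
    of [f].

    The second one, that [Phi x (f x)] may exceed [a], is overcome by scaling:
    write [f x = v * g] with [v = 1 + Phi x (f x) / a].  Convexity and [Phi x 0 = 0]
    give [Phi x g <= Phi x (f x) / v <= a], so the comparison applies to [g].
    The mean of the weights [v] over [B] is at most [1 + modular f <= 2], hence
    the mean of [f] is a bounded multiple of a sub-convex combination of the
    vectors [g], and Jensen's inequality for [Phi y] gives the result, with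
    [beta] replaced by [beta / 4] ([transferred_jensen]).

    Jensen's inequality is only used for finite sums.  The passage to the
    integral goes through Riemann sums: [riemann_sum_near_integral] provides
    finitely many points and weights whose sum is close to the mean of [f] while
    the corresponding sum of [Phi x (f x)] exceeds its integral by little, and
    the continuity of [Phi y] removes the error
    ([transferred_integral_jensen]).  The function [x |-> Phi x (f x)] need not
    be measurable; its integral is then a lower integral, and the Riemann sums
    only require that such an integral dominates every simple function below
    the integrand ([le_lower_integral]). *)

(** * Borel sets, density and integrals without measurability *)

Lemma rV_dense_seq (R : realType) (m : nat) :
  exists q : nat -> 'rV[R]_m,
    forall U : set 'rV[R]_m, open U -> U !=set0 -> exists k, U (q k).
Proof.
exists (fun k => map_mx ratr (odflt 0 (unpickle k : option 'rV[rat]_m))).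
move=> U Uo [v Uv].
have /nbhs_ballP[e /= e0 eU] : nbhs v U by apply: open_nbhs_nbhs; split.
have rat_near j : exists p : rat, ball (v 0 j) e (ratr p).
  have [||x [vjx [p _ px]]] := @dense_rat R (ball (v 0 j) e).
  - by exists (v 0 j); exact: ballxx.
  - exact: ball_open.
  - by exists p; rewrite px.
have [p pv] := choice rat_near.
exists (pickle (\row_j p j)); apply: eU; rewrite pickleK /=.
by split=> // i j; rewrite !mxE ord1.
Qed.

(** Neither integrand is assumed measurable: the integral of a nonnegative
    function is defined as a supremum over the simple functions below it, which
    is monotone for every integrand. *)
Lemma le_lower_integral d (T : measurableType d) (R : realType)
    (mu : {measure set T -> \bar R}) (D E : set T) (f g : T -> \bar R) :
    (forall x, D x -> 0 <= f x)%E -> (forall x, E x -> 0 <= g x)%E ->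
    D `<=` E -> (forall x, D x -> f x <= g x)%E ->
  (\int[mu]_(x in D) f x <= \int[mu]_(x in E) g x)%E.
Proof.
move=> f0 g0 DE fg; rewrite !ge0_integralE//.
apply: le_ereal_sup => _ [h /= hf <-]; exists h => // x.
apply: le_trans (hf x) _; rewrite !patchE.
case: ifPn => [/set_mem Dx|_]; first by rewrite mem_set//; [exact: fg|exact: DE].
by case: ifPn => [/set_mem /g0|].
Qed.

Lemma borelRn_measurable_open (R : realType) k (U : set 'rV[R]_k) :
  open U -> measurable (U : set (borelRn R k)).
Proof. by move=> oU; exact: sub_sigma_algebra. Qed.

Lemma continuous_borelRn_measurable (R : realType) k (h : 'rV[R]_k -> R) :
  continuous h -> measurable_fun setT (h : borelRn R k -> R).
Proof.
move=> /continuousP ch; apply: (measurability _ (RGenOpens.measurableE R)).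
move=> _ [_ [a [b ->] <-]]; rewrite setTI.
by apply: borelRn_measurable_open; apply: ch; exact: interval_open.
Qed.

(** The preimages under [f] of small balls around a dense sequence cover [D];
    removing from each of them the previous ones makes them disjoint. *)
Lemma small_oscillation_partition d (T : measurableType d) (R : realType)
    (m : nat) (D : set T) (f : T -> 'rV[R]_m) (e : R) :
    measurable D -> measurable_fun D (f : T -> borelRn R m) -> 0 < e ->
  exists P : nat -> set T,
    [/\ forall i, measurable (P i), trivIset setT P, \bigcup_i P i = D &
        forall i x y, P i x -> P i y -> `|f x - f y| <= e].
Proof.
move=> mD mf e0; have [q dq] := rV_dense_seq R m.
have e20 : 0 < e / 2 by rewrite divr_gt0.
pose Q i := D `&` f @^-1` ball (q i) (e / 2).
exists (seqDU Q); split.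
- apply: seqDU_measurable => i; apply: mf => //.
  by apply: borelRn_measurable_open; exact: ball_open.
- exact: trivIset_seqDU.
- rewrite -seqDU_bigcup_eq; apply/seteqP; split; first by move=> x [i _ []].
  move=> x Dx; have [||k fk] := dq (ball (f x) (e / 2)).
  + exact: ball_open.
  + by exists (f x); exact: ballxx.
  + by exists k => //; split => //=; exact: ball_sym.
- move=> i x y [[_ /= qx] _] [[_ /= qy] _].
  apply: ltW; have := ball_split (ball_sym qx) qy.
  by rewrite -ball_normE.
Qed.

(** * Riemann sums *)

(** Finiteness of the integral is what makes the infimum finite: otherwise [F]
    would be infinite on a set of positive measure. *)
Lemma exists_near_ereal_inf d (T : measurableType d) (R : realType)
    (mu : {measure set T -> \bar R}) (D : set T) (F : T -> \bar R) (e : R) :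
    measurable D -> (0 < mu D)%E -> (forall x, D x -> 0 <= F x)%E ->
    (\int[mu]_(x in D) F x < +oo)%E -> 0 < e ->
  exists2 x, D x & (F x <= (fine (ereal_inf (F @` D)) + e)%:E)%E.
Proof.
move=> mD D0 F0 Foo e0.
have inf_fin : ereal_inf (F @` D) \is a fin_num.
  rewrite ge0_fin_numE; last by apply: le_ereal_inf_tmp => y [x Dx <-]; exact: F0.
  rewrite ltey; apply/eqP => infy; move: Foo; rewrite ltNge => /negP; apply.
  have -> : +oo%E = (\int[mu]_(x in D) cst +oo%E x)%E.
    by rewrite integral_cst// gt0_mulye.
  apply: le_lower_integral => //= x Dx.
  by rewrite -infy; apply: ereal_inf_lbound; exists x.
have [_ [x Dx <-] Fx] := lb_ereal_inf_adherent e0 inf_fin.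
by exists x => //; rewrite EFinD fineK//; exact: ltW.
Qed.

(** The left side is the integral of the simple function equal to [c i] on
    [P i] for [i < n] and to [0] elsewhere, and this function is below [F]. *)
Lemma lower_sum_le_integral d (T : measurableType d) (R : realType)
    (mu : {measure set T -> \bar R}) (D : set T) (F : T -> \bar R)
    (P : nat -> set T) (c : nat -> R) (n : nat) :
    measurable D -> (mu D < +oo)%E -> (forall x, D x -> 0 <= F x)%E ->
    (forall i, measurable (P i)) -> trivIset setT P ->
    (forall i, P i `<=` D) -> (forall i, 0 <= c i) ->
    (forall i x, P i x -> (c i)%:E <= F x)%E ->
  ((\sum_(i < n) fine (mu (P i)) * c i)%:E <= \int[mu]_(x in D) F x)%E.
Proof.
move=> mD Doo F0 mP tP PD c0 cF.
have Pfin i : mu (P i) \is a fin_num.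
  rewrite ge0_fin_numE//; apply: le_lt_trans Doo.
  by apply: le_measure; rewrite ?inE//; exact: PD.
have -> : (\sum_(i < n) fine (mu (P i)) * c i)%:E =
    (\int[mu]_(x in D) \sum_(i < n) ((c i)%:E * (\1_(P i) x)%:E))%E.
  rewrite ge0_integral_sum//; last 2 first.
  - move=> i; apply: emeasurable_funM => //.
    by apply/measurable_EFinP; exact: measurable_indic.
  - by move=> i x _; rewrite -EFinM lee_fin mulr_ge0.
  rewrite -sumEFin; apply: eq_bigr => i _; rewrite ge0_integralZl_EFin//.
  - by rewrite integral_indic// setIidl// EFinM fineK// muleC.
  - by apply/measurable_EFinP; exact: measurable_indic.
apply: le_lower_integral => // x Dx.
  by apply: sume_ge0 => i _; rewrite -EFinM lee_fin mulr_ge0.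
have [[i Pix]|nP] := pselect (exists i : 'I_n, P i x).
  rewrite (bigD1 i)//= big1 ?adde0.
    by rewrite indicE mem_set// mule1; exact: cF.
  move=> j ji; rewrite indicE memNset ?mule0// => Pjx.
  move/eqP: ji; apply; apply: val_inj.
  by apply: (tP j i) => //; exists x.
rewrite big1 ?F0// => i _; rewrite indicE memNset ?mule0// => Pix.
by apply: nP; exists i.
Qed.


Lemma integral_tail_small d (T : measurableType d) (R : realType)
    (mu : {measure set T -> \bar R}) (D : set T) (H : T -> R)
    (P : nat -> set T) (e : R) :
    (forall x, 0 <= H x) -> mu.-integrable D (EFin \o H) ->
    (forall i, measurable (P i)) -> \bigcup_i P i = D -> 0 < e ->
  exists n, \int[mu]_(x in D `\` \big[setU/set0]_(i < n) P i) H x <= e.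
Proof.
move=> H0 iH mP PD e0; pose E n := \big[setU/set0]_(i < n) P i.
have mE n : measurable (E n) by exact: bigsetU_measurable.
have mD : measurable D by rewrite -PD; exact: bigcupT_measurable.
have ED n : E n `<=` D.
  by rewrite /E -bigcup_mkord -PD => x [i _ Pix]; exists i.
have DE : \bigcup_n E n = D.
  apply/seteqP; split=> [x [n _ /ED]//|]; rewrite -PD => x [i _ Pix].
  by exists i.+1 => //; rewrite /E big_ord_recr; right.
have /fine_cvgP[_ cvgE] :
    (\int[mu]_(x in E n) (H x)%:E)%E @[n --> \oo] -->
    (\int[mu]_(x in D) H x)%:E.
  rewrite /Rintegral fineK; last exact: integrable_fin_num.
  rewrite -DE; apply: ge0_nondecreasing_set_cvg_integral => //.
  - move=> a b ab; rewrite subsetEset /E -!bigcup_mkord => x [i /= ia Pix].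
    by exists i => //=; exact: leq_trans ab.
  - move=> n; apply: (measurable_funS mD (ED n)).
    exact: measurable_int iH.
  - by move=> n x _; rewrite lee_fin.
have [n _ /(_ n (leqnn n)) /= nE] := (cvgrPdist_le _ _).1 cvgE _ e0.
exists n; apply: le_trans nE; apply: le_trans (ler_norm _).
rewrite -/(E n) -[D in X in _ <= X - _](setDUK (ED n)).
rewrite Rintegral_setU//.
- by rewrite addrAC subrr add0r.
- exact: measurableD.
- by rewrite setDUK.
- by apply/disj_setPS => x [? []].
Qed.

(** On the pieces that occur in the sum the integrand is within [e] of [c i]; the
    rest of [D], which the sum ignores, is bounded through the majorant [H]. *)
Lemma riemann_sum_error d (T : measurableType d) (R : realType)
    (mu : {measure set T -> \bar R}) (D : set T) (h H : T -> R)
    (P : nat -> set T) (c : nat -> R) (e : R) (n : nat) :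
    measurable D -> (mu D < +oo)%E ->
    mu.-integrable D (EFin \o h) -> mu.-integrable D (EFin \o H) ->
    (forall x, `|h x| <= H x) ->
    (forall i, measurable (P i)) -> trivIset setT P -> (forall i, P i `<=` D) ->
    (forall i x, P i x -> `|h x - c i| <= e) ->
  `|\int[mu]_(x in D) h x - \sum_(i < n) fine (mu (P i)) * c i|
    <= e * (\sum_(i < n) fine (mu (P i)))
       + \int[mu]_(x in D `\` \big[setU/set0]_(i < n) P i) H x.
Proof.
move=> mD Doo ih iH hH mP tP PD he; pose E k := \big[setU/set0]_(i < k) P i.
have mE k : measurable (E k) by exact: bigsetU_measurable.
have ED k : E k `<=` D.
  by rewrite /E -bigcup_mkord => x [i _ Pix]; exact: (PD i).
have ihS A : measurable A -> A `<=` D -> mu.-integrable A (EFin \o h).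
  by move=> mA AD; exact: integrableS ih.
have icst i r : mu.-integrable (P i) (EFin \o cst r).
  apply: measurable_bounded_integrable => //.
    by apply: le_lt_trans Doo; apply: le_measure; rewrite ?inE//; exact: PD.
  exact: bounded_cst.
have onE k : `|\int[mu]_(x in E k) h x - \sum_(i < k) fine (mu (P i)) * c i|
    <= e * (\sum_(i < k) fine (mu (P i))).
  elim: k => [|k IH].
    by rewrite /E !big_ord0 Rintegral_set0 subrr normr0 mulr0.
  rewrite /E !big_ord_recr/= -/(E k) Rintegral_setU//; last 2 first.
  - by apply: ihS; [exact: measurableU | rewrite subUset; split => //; exact: PD].
  - apply/disj_setPS; rewrite /E -bigcup_mkord => x [[i /= ik Pix] Pkx].
    have ik' : i = k by apply: (tP i k) => //; exists x.
    by rewrite ik' ltnn in ik.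
  rewrite opprD addrACA mulrDr; apply: le_trans (ler_normD _ _) _.
  apply: lerD => //.
  have -> : fine (mu (P k)) * c k = \int[mu]_(x in P k) cst (c k) x.
    by rewrite Rintegral_cst// mulrC.
  rewrite -RintegralB//; last exact: ihS.
  have iB : mu.-integrable (P k) (EFin \o (fun x => h x - c k)).
    apply: (@integrableB _ _ _ _ _ (mP k) (EFin \o h) (EFin \o cst (c k))) => //.
    exact: ihS.
  apply: le_trans (le_normr_Rintegral _ _) _ => //.
  rewrite -Rintegral_cst//; apply: le_Rintegral => //.
  - exact: integrable_abse iB.
  - exact: icst.
  - by move=> x; exact: he.
rewrite -/(E n) -[D in X in X <= _](setDUK (ED n)) Rintegral_setU//.
- rewrite addrAC; apply: le_trans (ler_normD _ _) _.
  apply: lerD => //.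
  have mDE : measurable (D `\` E n) by exact: measurableD.
  have iDE : mu.-integrable (D `\` E n) (EFin \o h) by exact: ihS.
  apply: le_trans (le_normr_Rintegral _ _) _ => //.
  apply: le_Rintegral => //.
  + exact: integrable_abse iDE.
  + exact: integrableS iH.
- exact: measurableD.
- by rewrite setDUK.
- by apply/disj_setPS => x [? []].
Qed.

Lemma coord_le_norm (R : realType) (m : nat) (v : 'rV[R]_m) (j : 'I_m) :
  `|v 0 j| <= `|v|.
Proof.
rewrite [leRHS]/Num.Def.normr/= mx_normrE.
by apply/bigmax_geP; right => /=; exists (0, j).
Qed.

Lemma integrable_coord d (T : measurableType d) (R : realType) (m : nat)
    (mu : {measure set T -> \bar R}) (D : set T) (f : T -> 'rV[R]_m)
    (j : 'I_m) :
    measurable D -> measurable_fun D (f : T -> borelRn R m) ->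
    mu.-integrable D (fun x => `|f x|%:E) ->
  mu.-integrable D (fun x => (f x 0 j)%:E).
Proof.
move=> mD mf iN; apply: le_integrable iN => //.
  apply/measurable_EFinP.
  apply: (@measurableT_comp _ _ _ _ _ _ (fun v : borelRn R m => v 0 j)) mf.
  by apply: continuous_borelRn_measurable; exact: coord_continuous.
by move=> y _; rewrite /= lee_fin normr_id; exact: coord_le_norm.
Qed.

(** Take a partition of [D] into countably many pieces on which [f] oscillates
    little, truncate it, and choose in each piece of positive measure a point
    where [F] is close to its infimum over the piece: the lower sums of [F] bound
    the integral from below, while the value of [f] at any point of the piece is
    a good approximation.  The numbers [b i] are finite upper bounds for
    [F (x i)]; nothing is claimed about [F (x i)] when [w i = 0], as [F] may be
    infinite on a whole piece of measure zero. *)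
Lemma riemann_sum_near_integral d (T : measurableType d) (R : realType)
    (m : nat) (mu : {measure set T -> \bar R}) (D : set T)
    (f : T -> 'rV[R]_m) (F : T -> \bar R) (e : R) :
    measurable D -> (0 < mu D < +oo)%E ->
    measurable_fun D (f : T -> borelRn R m) ->
    mu.-integrable D (fun x => `|f x|%:E) ->
    (forall x, D x -> 0 <= F x)%E -> (\int[mu]_(x in D) F x < +oo)%E ->
    0 < e ->
  exists (n : nat) (x : nat -> T) (w b : nat -> R),
    [/\ forall i, [/\ D (x i), 0 <= w i, 0 <= b i &
                      0 < w i -> (F (x i) <= (b i)%:E)%E],
        \sum_(i < n) w i <= fine (mu D),
        ((\sum_(i < n) w i * b i)%:E <= \int[mu]_(x in D) F x + e%:E)%E &
        `|(\row_j \int[mu]_(x in D) f x 0 j) - \sum_(i < n) w i *: f (x i)|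
          <= e].
Proof.
move=> mD /andP[D0 Doo] mf iN F0 Foo e0.
set M := fine (mu D).
have M0 : 0 < M by rewrite fine_gt0// D0.
(* [eta] is both the oscillation of [f] on the pieces and the distance of
   [F (x i)] from the infimum; either way its total contribution is
   [eta * M = e / 2]. *)
pose eta := e / (2 * M).
have eta0 : 0 < eta by rewrite divr_gt0// mulr_gt0.
have etaM : eta * M = e / 2 by rewrite /eta; field; exact: lt0r_neq0.
have [P [mP tP PD oscP]] := @small_oscillation_partition _ _ _ _ _ _ _ mD mf eta0.
have PsubD i : P i `<=` D by rewrite -PD => x Pix; exists i.
have Pfin i : mu (P i) \is a fin_num.
  rewrite ge0_fin_numE//; apply: le_lt_trans Doo.
  by apply: le_measure; rewrite ?inE.
pose c i := fine (ereal_inf (F @` P i)).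
have inf0 i : (0 <= ereal_inf (F @` P i))%E.
  by apply: le_ereal_inf_tmp => y [x /PsubD Dx <-]; exact: F0.
have c0 i : 0 <= c i by exact: fine_ge0.
have cF i x : P i x -> ((c i)%:E <= F x)%E.
  move=> Pix; have : (ereal_inf (F @` P i) <= F x)%E.
    by apply: ereal_inf_lbound; exists x.
  rewrite /c; case: (ereal_inf (F @` P i)) (inf0 i) => //= _ _.
  by apply: F0; exact: PsubD Pix.
(* Value of the sample point for the empty pieces. *)
have [x0 Dx0] : D !=set0.
  by apply/set0P/eqP => D_0; rewrite D_0 measure0 ltxx in D0.
have pick i : exists x, [/\ D x, P i !=set0 -> P i x &
    0 < fine (mu (P i)) -> (F x <= (c i + eta)%:E)%E].
  have [Pi0|Pi0] := pselect (0 < fine (mu (P i))).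
    have [|||x Pix Fx] :=
        @exists_near_ereal_inf _ _ _ mu (P i) F eta (mP i) _ _ _ eta0.
    - by move: Pi0; rewrite -lte_fin fineK.
    - by move=> x /PsubD; exact: F0.
    - apply: le_lt_trans Foo; apply: le_lower_integral => // x /PsubD; exact: F0.
    - by exists x; split=> //; exact: PsubD Pix.
  have [[x Pix]|nP] := pselect (P i !=set0).
    by exists x; split=> //; exact: PsubD Pix.
  by exists x0.
have [x xP] := choice pick.
have e20 : 0 < e / 2 by rewrite divr_gt0.
have [n tail] := @integral_tail_small _ _ _ mu D (fun y => `|f y|) P _
  (fun y => normr_ge0 (f y)) iN mP PD e20.
have sumPM : \sum_(i < n) fine (mu (P i)) <= M.
  rewrite -lee_fin /M fineK; last by rewrite ge0_fin_numE.
  rewrite -sumEFin; under eq_bigr do rewrite fineK//.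
  rewrite -(measure_bigsetU _ mP tP).
  apply: le_measure; rewrite ?inE//; first exact: bigsetU_measurable.
  by rewrite -bigcup_mkord => y [i _ /PsubD].
exists n, x, (fun i => fine (mu (P i))), (fun i => c i + eta); split=> //.
- move=> i; have [Dx _ Fx] := xP i.
  by split=> //; rewrite addr_ge0// ltW.
- under eq_bigr do rewrite mulrDr.
  rewrite big_split/= -mulr_suml EFinD; apply: leeD.
    exact: lower_sum_le_integral.
  rewrite lee_fin; apply: (@le_trans _ _ (M * eta)).
    by rewrite ler_wpM2r// ltW.
  by rewrite mulrC etaM [leRHS](splitr e) lerDl ltW.
- rewrite [leLHS]/Num.Def.normr/= mx_normrE (bigmax_le _ (ltW e0))//= => -[i j] _.
  rewrite !mxE summxE ord1 /=.
  have ifj := integrable_coord j mD mf iN.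
  under eq_bigr do rewrite mxE.
  have osc_j l y : P l y -> `|f y 0 j - f (x l) 0 j| <= eta.
    move=> Ply; have [_ /(_ (ex_intro _ y Ply)) Plx _] := xP l.
    apply: le_trans (oscP l y (x l) Ply Plx).
    by have := coord_le_norm (f y - f (x l)) j; rewrite !mxE.
  apply: le_trans (riemann_sum_error n mD Doo ifj iN
    (fun y => coord_le_norm (f y) j) mP tP PsubD osc_j) _.
  have : eta * (\sum_(k < n) fine (mu (P k))) <= e / 2.
    by rewrite -etaM ler_wpM2l// ltW.
  by move=> h; rewrite [leRHS](splitr e); exact: lerD.
Qed.

(** * Convex functions with values in [0, +oo] *)

Definition convex_nonneg_zero (R : realType) (V : lmodType R)
    (phi : V -> \bar R) : Prop :=
  [/\ forall xi, (0 <= phi xi)%E, phi 0 = 0%E &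
      forall (xi eta : V) (t : R), 0 <= t <= 1 ->
        (phi (t *: xi + (1 - t) *: eta)%R
           <= t%:E * phi xi + (1 - t)%R%:E * phi eta)%E].

Lemma convex_scale (R : realType) (V : lmodType R) (phi : V -> \bar R)
    (xi : V) (t : R) :
  convex_nonneg_zero phi -> 0 <= t <= 1 -> (phi (t *: xi) <= t%:E * phi xi)%E.
Proof.
move=> [_ phi0 phiC] /(phiC xi 0).
by rewrite phi0 scaler0 addr0 mule0 adde0.
Qed.

(** Since [phi 0 = 0], the weight missing from [1] may be put at the origin, so
    the weights need only add up to at most [1]. *)
Lemma jensen_subconvex (R : realType) (V : lmodType R) (phi : V -> \bar R)
    (n : nat) (lam : nat -> R) (xi : nat -> V) :
    convex_nonneg_zero phi -> (forall i, 0 <= lam i) ->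
    \sum_(i < n) lam i <= 1 ->
  (phi (\sum_(i < n) lam i *: xi i)%R <= \sum_(i < n) (lam i)%:E * phi (xi i))%E.
Proof.
move=> phiC; have [phi_ge0 phi0 phi_conv] := phiC.
elim: n lam => [|n IH] lam lam0; first by rewrite !big_ord0 phi0.
rewrite !big_ord_recr/= => sum1.
have sum0 : 0 <= \sum_(i < n) lam i by exact: sumr_ge0.
(* When the last weight is [1] the other ones vanish; otherwise they are
   renormalised by [1 - lam n], which keeps their sum at most [1]. *)
have [lamn1|lamn1] := leP 1 (lam n).
  have /eqP : \sum_(i < n) lam i = 0.
    by apply/eqP; rewrite eq_le sum0 andbT; lra.
  rewrite psumr_eq0// => /allP lamz.
  have lam_eq0 (i : 'I_n) : lam i = 0.
    by apply/eqP/lamz; rewrite mem_index_enum.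
  rewrite big1 => [|i _]; last by rewrite lam_eq0 scale0r.
  rewrite big1 => [|i _]; last by rewrite lam_eq0 mul0e.
  have -> : lam n = 1 by lra.
  by rewrite add0r add0e scale1r mul1e.
have d0 : 0 < 1 - lam n by lra.
pose nu i := lam i / (1 - lam n).
have nu0 i : 0 <= nu i by rewrite divr_ge0// ltW.
have nu1 : \sum_(i < n) nu i <= 1.
  by rewrite -mulr_suml ler_pdivrMr// mul1r; lra.
have lamE i : lam i = (1 - lam n) * nu i.
  by rewrite /nu mulrC divfK// gt_eqF.
have -> : \sum_(i < n) lam i *: xi i =
    (1 - lam n) *: \sum_(i < n) nu i *: xi i.
  by rewrite scaler_sumr; apply: eq_bigr => i _; rewrite scalerA -lamE.
have -> : (\sum_(i < n) (lam i)%:E * phi (xi i) =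
    (1 - lam n)%:E * \sum_(i < n) (nu i)%:E * phi (xi i))%E.
  rewrite ge0_sume_distrr; last by move=> i _; rewrite mule_ge0// lee_fin.
  by apply: eq_bigr => i _; rewrite muleA -EFinM -lamE.
rewrite addrC addeC; apply: le_trans (phi_conv _ _ _ _) _.
  by rewrite lam0/=; lra.
by apply: leeD2l; apply: lee_wpmul2l; [rewrite lee_fin ltW|exact: IH].
Qed.

(** The comparison between [phi] and [psi i] is available only where
    [psi i <= a], and [xi i] may violate this.  Dividing [xi i] by
    [v i = 1 + b i / a] repairs it, by convexity of [psi i], because
    [b i / v i <= a].  The price is that the weights become [a * w i * v i],
    whose sum is at most [a * sum w + sum (w * b) <= 3]; the factor [4] turns
    them into sub-convex weights and leaves room for the additive constant. *)
Lemma transferred_jensen (R : realType) (V : lmodType R)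
    (phi : V -> \bar R) (psi : nat -> V -> \bar R)
    (n : nat) (w b : nat -> R) (xi : nat -> V) (a beta : R) :
    convex_nonneg_zero phi -> (forall i, convex_nonneg_zero (psi i)) ->
    0 < a ->
    (forall i eta, (psi i eta <= a%:E)%E ->
       (phi (beta *: eta) <= psi i eta + 1)%E) ->
    (forall i, [/\ 0 <= w i, 0 <= b i &
       0 < w i -> (psi i (xi i) <= (b i)%:E)%E]) ->
    a * (\sum_(i < n) w i) <= 1 -> \sum_(i < n) w i * b i <= 2 ->
  (phi ((beta / 4) *: (a *: \sum_(i < n) w i *: xi i))%R
     <= ((a * (\sum_(i < n) w i * b i) + 3) / 4)%:E)%E.
Proof.
move=> phiC psiC a0 trans wb sumw sumwb.
pose v i := 1 + b i / a.
have v1 i : 1 <= v i.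
  by have [_ b0 _] := wb i; rewrite lerDl divr_ge0// ltW.
have v0 i : 0 < v i by exact: lt_le_trans (v1 i).
have avE i : a * v i = a + b i by rewrite /v; field; exact: lt0r_neq0.
pose lam i := a * w i * v i / 4.
have w0 i : 0 <= w i by have [] := wb i.
have lam0 i : 0 <= lam i by rewrite /lam !mulr_ge0// ltW.
have lamE i : lam i = (a * w i + w i * b i) / 4.
  by rewrite /lam (mulrAC a) avE; ring.
have sum_lam : \sum_(i < n) lam i =
    (a * (\sum_(i < n) w i) + \sum_(i < n) w i * b i) / 4.
  rewrite mulr_sumr -big_split/= mulr_suml.
  by apply: eq_bigr => i _; rewrite lamE.
have -> : (beta / 4) *: (a *: \sum_(i < n) w i *: xi i) =
    \sum_(i < n) lam i *: (beta *: ((v i)^-1 *: xi i)).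
  rewrite !scaler_sumr; apply: eq_bigr => i _; rewrite !scalerA.
  by congr (_ *: _); rewrite /lam; field; exact: lt0r_neq0.
have sum_lam1 : \sum_(i < n) lam i <= 1 by rewrite sum_lam; lra.
apply: le_trans (jensen_subconvex (fun i => beta *: ((v i)^-1 *: xi i))
  phiC lam0 sum_lam1) _.
apply: (@le_trans _ _ (\sum_(i < n) ((a * (w i * b i)) / 4 + lam i)%:E)%E).
  apply: lee_sum => i _.
  have [] := wb i; rewrite le_eqVlt => /predU1P[wi0|wi0] b0 psi_b.
    by rewrite /lam -wi0 !(mulr0, mul0r) add0r mul0e.
  have psi_v : (psi i ((v i)^-1 *: xi i) <= (b i / v i)%:E)%E.
    apply: le_trans (convex_scale _ (psiC i) _) _.
      by rewrite invr_ge0 ltW//= invf_le1.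
    rewrite mulrC EFinM; apply: lee_wpmul2l; last exact: psi_b.
    by rewrite lee_fin invr_ge0 ltW.
  have bva : b i / v i <= a.
    by rewrite ler_pdivrMr// avE lerDr ltW.
  apply: (@le_trans _ _ ((lam i)%:E * (b i / v i + 1)%:E)%E).
    apply: lee_wpmul2l; first by rewrite lee_fin.
    apply: le_trans (trans i _ _) _; last by rewrite EFinD leeD2r.
    by apply: le_trans psi_v _; rewrite lee_fin.
  rewrite -EFinM lee_fin le_eqVlt; apply/orP; left; apply/eqP.
  by rewrite /lam; field; exact: lt0r_neq0.
rewrite sumEFin lee_fin big_split/= sum_lam.
rewrite -mulr_suml -mulr_sumr; lra.
Qed.

(** If the inequality failed at [xi], it would fail on an open set of vectors
    satisfying [psi < C], by continuity of both functions in the topology of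
    the extended line, hence at some [q k]. *)
Lemma transfer_from_dense (R : realType) (m : nat) (q : nat -> 'rV[R]_m)
    (phi psi : 'rV[R]_m -> \bar R) (beta : R) (C : \bar R) :
    (forall U, open U -> U !=set0 -> exists k, U (q k)) ->
    continuous phi -> continuous psi ->
    (forall k, (psi (q k) < C)%E -> (phi (beta *: q k) <= psi (q k) + 1)%E) ->
  forall xi, (0 <= psi xi)%E -> (psi xi < C)%E ->
    (phi (beta *: xi) <= psi xi + 1)%E.
Proof.
move=> dq cphi cpsi hq xi psi0 psiC; rewrite leNgt; apply/negP => lt1.
have psi_fin : psi xi \is a fin_num.
  by rewrite ge0_fin_numE// (lt_le_trans psiC)// leey.
(* A real threshold [z] separates the two sides, which turns the failure into
   two open conditions; [phi] may be infinite at [beta *: xi]. *)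
have [z [z1 z2]] : exists z : R,
    (psi xi < z%:E)%E /\ ((z + 1)%:E < phi (beta *: xi))%E.
  move: lt1; rewrite -(fineK psi_fin); set r := fine _.
  case: (phi _) => [s| |] //=.
    rewrite -EFinD lte_fin => rs; exists ((r + (s - 1)) / 2).
    by rewrite !lte_fin; split; lra.
  by move=> _; exists (r + 1); rewrite lte_fin ltry; split => //; lra.
have cphib : continuous (fun eta : 'rV[R]_m => phi (beta *: eta)).
  move=> eta; apply: continuous_comp; last exact: cphi.
  exact: scaler_continuous.
have [||k [[/= k1 k2] k3]] := dq ((psi @^-1` [set y | (y < C)%E] `&`
    psi @^-1` [set y | (y < z%:E)%E]) `&`
    (fun eta : 'rV[R]_m => phi (beta *: eta)) @^-1` [set y | ((z + 1)%:E < y)%E]).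
- apply: openI; last by apply: (continuousP _).1 => //; exact: open_ereal_gt_ereal.
  by apply: openI; apply: (continuousP _).1 => //; exact: open_ereal_lt_ereal.
- by exists xi.
- have := lt_le_trans k3 (hq k k1); rewrite ltNge => /negP; apply.
  by rewrite EFinD leeD2r// ltW.
Qed.

(** * The Euclidean norm *)

Lemma enorm_continuous (R : realType) (k : nat) :
  continuous (@enorm R k).
Proof.
move=> v; apply: continuous_comp; last exact: sqrt_continuous.
apply: continuous_big => [|j _ {}v]; first exact: add_continuous.
apply: (@continuous_comp _ _ _ (fun u : 'rV[R]_k => u 0 j) (fun s => s ^+ 2)).
- exact: coord_continuous.
- exact: exprn_continuous.
Qed.

Lemma open_eball (R : realType) (k : nat) (c : 'rV[R]_k) (r : R) :
  open (eball c r).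
Proof.
rewrite (_ : eball c r = (fun y => enorm (y - c)) @^-1` [set s | s < r])//.
apply: (continuousP _).1; last exact: open_lt.
move=> y; apply: (@continuous_comp _ _ _ (fun y : 'rV[R]_k => y - c)).
  by apply: (@cvgB _ _ _ (nbhs y) _ id (cst c)); [exact: cvg_id|exact: cvg_cst].
exact: enorm_continuous.
Qed.

(** Links the library norm, in which the Riemann sum estimates are made, to the
    Euclidean one, in which integrability is given. *)
Lemma norm_le_enorm (R : realType) (k : nat) (v : 'rV[R]_k) :
  `|v| <= enorm v.
Proof.
have enorm0 : 0 <= enorm v by exact: sqrtr_ge0.
rewrite [leLHS]/Num.Def.normr/= mx_normrE (bigmax_le _ enorm0)//= => -[i j] _.
rewrite ord1 /= -sqrtr_sqr ler_sqrt; last by apply: sumr_ge0 => l _; exact: sqr_ge0.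
by rewrite (bigD1 j)//= lerDl sumr_ge0// => l _; exact: sqr_ge0.
Qed.

Lemma L1_vec_norm_integrable (R : realType) (n m : nat)
    (mu : {measure set (borelRn R n) -> \bar R}) (Omega : set 'rV[R]_n)
    (f : 'rV[R]_n -> 'rV[R]_m) :
  measurable (Omega : set (borelRn R n)) -> L1_vec mu Omega f ->
  mu.-integrable Omega (fun x => `|f x|%:E).
Proof.
move=> mO [mf foo].
have comp (h : 'rV[R]_m -> R) : continuous h ->
    measurable_fun (Omega : set (borelRn R n)) (fun x => (h (f x))%:E).
  move=> ch; apply/measurable_EFinP.
  apply: (@measurableT_comp _ _ _ _ _ _ (h : borelRn R m -> R)) mf.
  exact: continuous_borelRn_measurable.
apply: (@le_integrable _ _ _ _ _ mO _ (fun x => (enorm (f x))%:E)).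
- by apply: comp; exact: norm_continuous.
- move=> x _; rewrite /= lee_fin normr_id.
  by apply: le_trans (ler_norm _); exact: norm_le_enorm.
- apply/integrableP; split; first by apply: comp; exact: enorm_continuous.
  by under eq_integral do rewrite gee0_abs ?lee_fin ?sqrtr_ge0//.
Qed.

(** * The ball condition as a comparison between points *)

(** For a single vector [xi] almost every [x] satisfies
    [Phi_minus xi <= Phi x xi] and almost every [y] satisfies
    [Phi y (beta xi) <= Phi_plus (beta xi)], but the null sets depend on [xi].
    Only a countable dense set of vectors is used, and continuity of [Phi x] and
    [Phi y] extends the resulting comparison to all vectors.  The inequality
    [Phi x xi < C] is strict in order to be an open condition on [xi]. *)
Lemma strong_Phi_ae_transfer (R : realType) (n m : nat)
    (mu : {measure set (borelRn R n) -> \bar R})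
    (Omega B : set 'rV[R]_n) (Phi : 'rV[R]_n -> 'rV[R]_m -> \bar R)
    (C : \bar R) (beta : R) :
    strong_Phi_function mu Omega Phi ->
    (forall xi, (Phi_minus mu Omega Phi B xi <= C)%E ->
      (Phi_plus mu Omega Phi B (beta *: xi)
         <= Phi_minus mu Omega Phi B xi + 1)%E) ->
  exists N : set (borelRn R n), [/\ measurable N, mu N = 0%E &
    forall x, (B `&` Omega) x -> ~ N x ->
      [/\ convex_nonneg_zero (Phi x), continuous (Phi x) &
          forall y, (B `&` Omega) y -> ~ N y -> forall xi,
            (Phi x xi < C)%E -> (Phi y (beta *: xi) <= Phi x xi + 1)%E]].
Proof.
move=> [Phi0 _ Phi_at0 _ _ Phic Phiconv] trans.
have [q dq] := rV_dense_seq R m.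
pose good x := [/\ Omega x -> convex_nonneg_zero (Phi x),
   Omega x -> continuous (Phi x) &
   forall k, (B `&` Omega) x ->
     (Phi_minus mu Omega Phi B (q k) <= Phi x (q k))%E /\
     (Phi x (beta *: q k) <= Phi_plus mu Omega Phi B (beta *: q k))%E].
have aeF := ae_filter_ringOfSetsType mu.
have : \forall x \ae mu, good x.
  have ae_minmax : \forall x \ae mu, forall k, (B `&` Omega) x ->
     (Phi_minus mu Omega Phi B (q k) <= Phi x (q k))%E /\
     (Phi x (beta *: q k) <= Phi_plus mu Omega Phi B (beta *: q k))%E.
    apply: ae_foralln => k.
    have := ess_inf_le mu
      (patch (cst +oo%E) (B `&` Omega) (fun x => Phi x (q k))).
    have := ess_sup_ge mu
      (patch (cst -oo%E) (B `&` Omega) (fun x => Phi x (beta *: q k))).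
    apply: filterS2 => x le_sup ge_inf Bx.
    by move: le_sup ge_inf; rewrite /patch mem_set.
  have ae_convex : \forall x \ae mu, Omega x -> convex_nonneg_zero (Phi x).
    move: Phi_at0 Phiconv; apply: (@filterS2 _ _ aeF) => x at0 conv Ox.
    by split; [move=> xi; exact: Phi0|exact: at0|exact: conv].
  by move: ae_convex Phic ae_minmax; apply: (@filterS3 _ _ aeF) => x; split.
move=> [N [mN muN goodN]]; exists N; split=> // x Bx Nx.
have {}goodN z : ~ N z -> good z by move=> Nz; apply: contrapT => /goodN.
have [convx contx minmaxx] := goodN x Nx; have [_ Ox] := Bx.
split; [exact: convx|exact: contx|move=> y By Ny xi xiC].
have [_ conty minmaxy] := goodN y Ny; have [_ Oy] := By.
apply: (transfer_from_dense dq (conty Oy) (contx Ox)) xiC => [k qC|].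
- have [inf_le _] := minmaxx k Bx; have [_ sup_ge] := minmaxy k By.
  apply: le_trans sup_ge _; apply: le_trans (trans _ _) _.
  + by apply: le_trans inf_le _; exact: ltW.
  + by rewrite leeD2r.
- exact: Phi0.
Qed.

(** * Jensen's inequality for means *)

(** Integral form of [transferred_jensen]: the Riemann sums of [f] and of
    [psi x (f x)] satisfy the hypotheses of the finite inequality, and if the
    conclusion failed at the mean of [f], continuity of [phi] would make it fail
    at a close enough Riemann sum. *)
Lemma transferred_integral_jensen d (T : measurableType d) (R : realType)
    (m : nat) (mu : {measure set T -> \bar R}) (D : set T)
    (f : T -> 'rV[R]_m) (phi : 'rV[R]_m -> \bar R)
    (psi : T -> 'rV[R]_m -> \bar R) (a beta : R) :
    measurable D -> (0 < mu D < +oo)%E ->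
    measurable_fun D (f : T -> borelRn R m) ->
    mu.-integrable D (fun x => `|f x|%:E) ->
    convex_nonneg_zero phi -> continuous phi ->
    (forall x, D x -> convex_nonneg_zero (psi x)) ->
    1 <= a -> a * fine (mu D) <= 1 ->
    (forall x eta, D x -> (psi x eta <= a%:E)%E ->
       (phi (beta *: eta) <= psi x eta + 1)%E) ->
    (\int[mu]_(x in D) psi x (f x) <= 1)%E ->
  (phi ((beta / 4) *: (a *: \row_j \int[mu]_(x in D) f x 0 j))%R
     <= a%:E * (\int[mu]_(x in D) psi x (f x)) + 1)%E.
Proof.
move=> mD muD mf iN phiC cphi psiC a1 aD trans int1.
have a0 : 0 < a by exact: lt_le_trans a1.
have psi0 x : D x -> (0 <= psi x (f x))%E by move=> /psiC[].
set I := \row_j _; set J := (\int[mu]_(x in D) psi x (f x))%E.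
have J0 : (0 <= J)%E by exact: integral_ge0.
rewrite leNgt; apply/negP => lt_I.
pose g (z : 'rV[R]_m) := phi ((beta / 4) *: (a *: z)).
have contg : continuous g.
  move=> z; apply: continuous_comp; last exact: cphi.
  apply: (@continuous_comp _ _ _ (fun z : 'rV[R]_m => a *: z)).
    exact: scaler_continuous.
  exact: scaler_continuous.
have /nbhs_ballP[e /= e0 eg] :
    nbhs I (g @^-1` [set s | (a%:E * J + 1 < s)%E]).
  apply: contg; apply: open_nbhs_nbhs; split; last exact: lt_I.
  exact: open_ereal_gt_ereal.
(* The bound [a^-1] keeps the excess of the sum of [psi] over its integral below
   [1] after multiplication by [a]. *)
pose e' := Num.min (e / 2) a^-1.
have e'0 : 0 < e' by rewrite lt_min divr_gt0// invr_gt0.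
have e'a : e' <= a^-1 by rewrite ge_min lexx orbT.
have Joo : (J < +oo)%E by apply: le_lt_trans int1 _; exact: ltry.
have [k [x [w [b [xP sumw sumwb near_I]]]]] :=
  riemann_sum_near_integral mD muD mf iN psi0 Joo e'0.
have /eg : ball I e (\sum_(i < k) w i *: f (x i)).
  rewrite -ball_normE /=; apply: le_lt_trans near_I _.
  by rewrite gt_min ltr_pdivrMr// ltr_pMr// ltr1n.
rewrite /= ltNge => /negP; apply.
have sumwb_mean : ((a * \sum_(i < k) w i * b i)%:E <= a%:E * J + 1)%E.
  have aE0 : (0 <= a%:E)%E by rewrite lee_fin ltW.
  rewrite EFinM; apply: le_trans (lee_wpmul2l aE0 sumwb) _.
  rewrite ge0_muleDr//; last by rewrite lee_fin ltW.
  by apply: leeD => //; rewrite -EFinM lee_fin -ler_pdivlMl// mulr1.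
have sumwb2 : \sum_(i < k) w i * b i <= 2.
  rewrite -lee_fin; apply: le_trans sumwb _; rewrite -[2]/(1 + 1) EFinD.
  apply: leeD => //; rewrite lee_fin; apply: le_trans e'a _.
  by rewrite invf_le1.
have sumw1 : a * \sum_(i < k) w i <= 1.
  by apply: le_trans aD; rewrite ler_wpM2l// ltW.
have xC i : convex_nonneg_zero (psi (x i)) by have [/psiC] := xP i.
have xtrans i eta : (psi (x i) eta <= a%:E)%E ->
    (phi (beta *: eta) <= psi (x i) eta + 1)%E.
  by have [Dx _ _ _] := xP i; exact: trans.
have wb i : [/\ 0 <= w i, 0 <= b i &
    0 < w i -> (psi (x i) (f (x i)) <= (b i)%:E)%E] by have [] := xP i.
apply: le_trans (transferred_jensen phiC xC a0 xtrans wb sumw1 sumwb2) _.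
have : (0 <= a%:E * J)%E by rewrite mule_ge0// lee_fin ltW.
move: sumwb_mean; case: (a%:E * J)%E => [p||] //.
  by rewrite -EFinD !lee_fin => ? ?; lra.
by move=> _ _; rewrite addye// leey.
Qed.

Theorem corollary1p3 (R : realType) (n m : nat)
  (mu : {measure set (borelRn R n) -> \bar R})
  (Omega : set 'rV[R]_n) (Omega_open : open Omega)
  (Phi : 'rV[R]_n -> 'rV[R]_m -> \bar R)
  (Phi_strong : strong_Phi_function mu Omega Phi)
  (Phi_ball : ball_condition mu Omega Phi)
  (f : 'rV[R]_n -> 'rV[R]_m) (f_LPhi : LPhi mu Omega Phi f) :
  exists beta : R, 0 < beta /\
    ((modular mu Omega Phi f <= 1)%E ->
     forall (c : 'rV[R]_n) (r : R), 0 < r ->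
     let B := eball c r in
     (mu B <= 1)%E -> (0 < mu (B `&` Omega))%E ->
     (Phi_plus mu Omega Phi B (beta *: vec_mean mu Omega B f)
        <= Phi_mean mu Omega Phi B f + 1)%E).
Proof.
(* Any [K > 1] would do: the strict inequality [Phi x xi < K / mu B] must cover
   all [xi] with [Phi x xi <= 1 / mu B]. *)
have [beta [beta0 trans]] := Phi_ball 2 (ltr0Sn R 1).
exists (beta / 4); split; first by rewrite divr_gt0.
move=> mod1 c r r0 B B1 BO0.
have mO : measurable (Omega : set (borelRn R n)).
  exact: borelRn_measurable_open.
have mB : measurable (B : set (borelRn R n)).
  by apply: borelRn_measurable_open; exact: open_eball.
have mBO : measurable (B `&` Omega : set (borelRn R n)) by exact: measurableI.
pose muB := fine (mu B).
have muBE : mu B = muB%:E.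
  by rewrite fineK// ge0_fin_numE// (le_lt_trans B1)// ltry.
have muB0 : 0 < muB.
  rewrite -lte_fin -muBE; apply: lt_le_trans BO0 _.
  by apply: le_measure; rewrite ?inE//; exact: subIsetl.
have muB1 : muB <= 1 by rewrite -lee_fin -muBE.
have invB : ((mu B)^-1 = (muB^-1)%:E)%E by rewrite muBE inver gt_eqF.
have [N [mN muN good]] :=
  strong_Phi_ae_transfer Phi_strong (trans c r r0 B1 BO0).
pose D : set (borelRn R n) := (B `&` Omega) `\` N.
have mD : measurable D by exact: measurableD.
have DO : D `<=` Omega by move=> x [[]].
have DB : D `<=` B by move=> x [[]].
have muD : mu D = mu (B `&` Omega).
  rewrite (measureDI mu mBO mN) [X in _ = _ + X](_ : _ = 0%E) ?adde0//.
  by apply: (subset_measure0 _ mN) => //; exact: measurableI.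
have muD_le : (mu D <= muB%:E)%E.
  by rewrite -muBE; apply: le_measure; rewrite ?inE.
have muD_bounds : (0 < mu D < +oo)%E.
  by rewrite muD BO0 -muD (le_lt_trans muD_le)// ltry.
have [L1f _] := f_LPhi.
have iN : mu.-integrable Omega (fun x => `|f x|%:E).
  exact: L1_vec_norm_integrable.
have Phi0 := Phi_ge0 Phi_strong.
have F0 x : D x -> (0 <= Phi x (f x))%E by move=> /DO Ox; exact: Phi0.
have F_mod : (\int[mu]_(x in D) Phi x (f x) <= 1)%E.
  by apply: le_trans mod1; apply: le_lower_integral => // x; exact: Phi0.
have F_mean : ((muB^-1)%:E * \int[mu]_(x in D) Phi x (f x)
    <= Phi_mean mu Omega Phi B f)%E.
  rewrite /Phi_mean invB; apply: lee_wpmul2l.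
    by rewrite lee_fin invr_ge0 ltW.
  apply: le_lower_integral => // x; rewrite /patch.
    by case: ifPn => // /set_mem Ox _; exact: Phi0.
  by move=> /DO Ox; rewrite mem_set.
have meanE : vec_mean mu Omega B f =
    muB^-1 *: \row_j \int[mu]_(x in D) f x 0 j.
  rewrite /vec_mean; congr (_ *: _); apply/rowP => j; rewrite !mxE.
  transitivity (\int[mu]_(x in B `&` Omega) f x 0 j).
    rewrite Rintegral_mkcondr; apply: eq_Rintegral => x _.
    by rewrite /patch; case: ifPn => // _; rewrite mxE.
  congr fine; apply: negligible_integral => //.
  exact: integrableS (integrable_coord j mO L1f.1 iN).
apply/ess_supP; exists N; split=> // y; apply: contra_notP => Ny.
rewrite /= /patch; case: ifPn => [/set_mem BOy|_]; last by rewrite /cst leNye.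
have [convy conty _] := good y BOy Ny.
rewrite meanE; apply: le_trans (leeD2r _ F_mean).
apply: transferred_integral_jensen => //.
- exact: measurable_funS L1f.1.
- exact: integrableS iN.
- by move=> x [BOx Nx]; have [] := good x BOx Nx.
- by rewrite invf_ge1.
- rewrite ler_pdivrMl// mulr1; have /andP[_ muDoo] := muD_bounds.
  by rewrite -lee_fin fineK// ge0_fin_numE.
- move=> x eta [BOx Nx] eta_le.
  have [_ _ /(_ y BOy Ny)] := good x BOx Nx; apply.
  rewrite -/B invB; apply: le_lt_trans eta_le _.
  by rewrite -EFinM lte_fin ltr_pMl ?invr_gt0// ltr1n.
Qed.
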